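(* Consider the four-node network with the setting described in the context. Under joint network and channel decoding at node 4, the achievable rate region $\Lambda_{\text{joint}}$ is the convex hull of all rate pairs $(R_A,R_B)$ satisfying $$R_A \le \mathbb{C}_{1,4}+\mathbb{C}'-\mathbb{C}'', \qquad R_B \le \mathbb{C}', \qquad R_A+R_B \le \mathbb{C}_{1,4}+\mathbb{C}',$$ where $\mathbb{C}_{1,4}=1-H(p_{1,4})$, $\mathbb{C}'=1-H(p')$ and $\mathbb{C}''=1-H(p'')$ with $$p' = [(1-p_{1,3})(1-p_{2,3})+p_{1,3}p_{2,3}]\,p_{3,4} + [p_{1,3}(1-p_{2,3})+(1-p_{1,3})p_{2,3}](1-p_{3,4}),$$ $$p'' = p_{1,3}(1-p_{2,3})(1-p_{3,4})(1-p_{1,4}) + (1-p_{1,3})p_{2,3}(1-p_{3,4})(1-p_{1,4}) + (1-p_{1,3})(1-p_{2,3})p_{3,4}(1-p_{1,4}) + (1-p_{1,3})(1-p_{2,3})(1-p_{3,4})p_{1,4} + (1-p_{1,3})p_{2,3}p_{3,4}p_{1,4} + p_{1,3}(1-p_{2,3})p_{3,4}p_{1,4} + p_{1,3}p_{2,3}(1-p_{3,4})p_{1,4} + p_{1,3}p_{2,3}p_{3,4}(1-p_{1,4}).$$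
   Context: Network: nodes $1,2,3,4$ with directed links $1\to3$, $1\to4$, $2\to3$, $3\to4$. Each link $i\to j$ is a binary symmetric channel (BSC) with crossover probability $p_{i,j}$: input $X_{i,j}\in\{0,1\}$, output $Y_{i,j}=X_{i,j}\oplus E_{i,j}$ with $\Pr\{E_{i,j}=1\}=p_{i,j}$; the link channels are independent, time invariant and memoryless. $H(p)=-p\log p-(1-p)\log(1-p)$ is the binary entropy function (base 2), and the capacity of a BSC with crossover $p$ is $1-H(p)$. Messages $A$ and $B$ are independent and uniformly distributed on $\{1,\dots,\lfloor 2^{nR_A}\rfloor\}$ and $\{1,\dots,\lfloor 2^{nR_B}\rfloor\}$, with $n$ the common block length (each link is used $n$ times). Node 1 encodes $A$ with a channel code into $\mathbf{X}_{1,3}(A)=\mathbf{X}_{1,4}(A)\in\{0,1\}^n$ and sends it on both links $1\to3$ and $1\to4$; node 2 encodes $B$ with a channel code into $\mathbf{X}_{2,3}(B)\in\{0,1\}^n$ and sends it on link $2\to3$. Node 3 performs no decoding: it transmits $\mathbf{X}_{3,4}=\mathbf{Y}_{1,3}\oplus\mathbf{Y}_{2,3}$ (bitwise XOR). Node 4 must estimate $(\hat A,\hat B)$ from $\mathbf{Y}_{1,4}$ and $\mathbf{Y}_{3,4}$; a rate pair is achievable if $\Pr\{(\hat A,\hat B)\neq(A,B)\}$ can be made arbitrarily small. Joint decoding: node 4 decodes $(A,B)$ jointly from the pair $(\mathbf{Y}_{1,4},\mathbf{Y}_{3,4})$. The achievable rate region of a strategy is the set of rate pairs achievable when node 4 uses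 that strategy.
   Formalization: The achievable rate region is taken as the closure of the set of achievable rate pairs, with rates nonnegative, since pairs on the boundary (e.g. R_B exactly equal to C') are in general not achievable with vanishing error. *)

(* Defs.v *)
From HB Require Import structures.
From mathcomp Require Import all_boot all_order all_algebra.
From mathcomp Require Import all_classical all_reals all_analysis.
Set Implicit Arguments. Unset Strict Implicit. Unset Printing Implicit Defensive.
Import Order.TTheory GRing.Theory Num.Theory.
Import numFieldNormedType.Exports.
Local Open Scope classical_set_scope.
Local Open Scope ring_scope.

Definition word (n : nat) := {ffun 'I_n -> bool}.

Definition wxor n (x y : word n) : word n := [ffun i => x i (+) y i].

Definition bsc_noise_prob (R : realType) (p : R) n (e : word n) : R :=
  \prod_(i < n) (if e i then p else 1 - p).

(* logarithm base 2 and binary entropy (with 0 log 0 = 0, since ln 0 = 0) *)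
Definition log2 (R : realType) (x : R) : R := ln x / ln 2.
Definition Hb (R : realType) (p : R) : R :=
  - (p * log2 p) - (1 - p) * log2 (1 - p).

Definition num_msgs (R : realType) (n : nat) (r : R) : nat :=
  Num.truncn (powR 2 (n%:R * r)).

(* Average (over uniform A, B and over the independent BSC noises) error
   probability of the scheme: node 1 sends f a on links 1->3 and 1->4,
   node 2 sends g b on link 2->3, node 3 forwards Y13 xor Y23 on link 3->4,
   node 4 decodes (A,B) jointly from (Y14, Y34) with decoder dec. *)
Definition err_prob (R : realType) (p13 p14 p23 p34 : R) (n MA MB : nat)
  (f : 'I_MA -> word n) (g : 'I_MB -> word n)
  (dec : word n -> word n -> 'I_MA * 'I_MB) : R :=
  (MA%:R * MB%:R)^-1 *
  \sum_(a : 'I_MA) \sum_(b : 'I_MB)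
   \sum_(e13 : word n) \sum_(e23 : word n) \sum_(e14 : word n) \sum_(e34 : word n)
     (bsc_noise_prob p13 e13 * bsc_noise_prob p23 e23 *
      bsc_noise_prob p14 e14 * bsc_noise_prob p34 e34 *
      (dec (wxor (f a) e14)
           (wxor (wxor (wxor (f a) e13) (wxor (g b) e23)) e34) != (a, b))%:R).

Definition achievable (R : realType) (p13 p14 p23 p34 : R) (rA rB : R) : Prop :=
  0 <= rA /\ 0 <= rB /\
  forall eps : R, 0 < eps -> exists N : nat, forall n : nat, (N <= n)%N ->
    exists (f : 'I_(num_msgs n rA) -> word n) (g : 'I_(num_msgs n rB) -> word n)
           (dec : word n -> word n -> 'I_(num_msgs n rA) * 'I_(num_msgs n rB)),
      err_prob p13 p14 p23 p34 f g dec <= eps.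

Definition joint_region (R : realType) (p13 p14 p23 p34 : R) : set (R * R) :=
  closure ([set r | achievable p13 p14 p23 p34 r.1 r.2] : set (R * R)).

Definition p_prime (R : realType) (p13 p23 p34 : R) : R :=
  ((1 - p13) * (1 - p23) + p13 * p23) * p34 +
  (p13 * (1 - p23) + (1 - p13) * p23) * (1 - p34).

Definition p_second (R : realType) (p13 p14 p23 p34 : R) : R :=
  p13 * (1 - p23) * (1 - p34) * (1 - p14) + (1 - p13) * p23 * (1 - p34) * (1 - p14)
  + (1 - p13) * (1 - p23) * p34 * (1 - p14) + (1 - p13) * (1 - p23) * (1 - p34) * p14
  + (1 - p13) * p23 * p34 * p14 + p13 * (1 - p23) * p34 * p14
  + p13 * p23 * (1 - p34) * p14 + p13 * p23 * p34 * (1 - p14).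

Definition conv_hull (R : realType) (S : set (R * R)) : set (R * R) :=
  [set z | exists (k : nat) (w : 'I_k -> R) (x : 'I_k -> R * R),
     (forall i, 0 <= w i) /\ \sum_(i < k) w i = 1 /\ (forall i, S (x i)) /\
     z = (\sum_(i < k) w i * (x i).1, \sum_(i < k) w i * (x i).2)].

Definition joint_bounds (R : realType) (p13 p14 p23 p34 : R) : set (R * R) :=
  let C14 := 1 - Hb p14 in
  let C' := 1 - Hb (p_prime p13 p23 p34) in
  let C'' := 1 - Hb (p_second p13 p14 p23 p34) in
  [set r | 0 <= r.1 /\ 0 <= r.2 /\
     r.1 <= C14 + C' - C'' /\ r.2 <= C' /\ r.1 + r.2 <= C14 + C'].

(* Main.v *)
Require Import Defs.
From HB Require Import structures.
From mathcomp Require Import all_boot all_order all_algebra.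
From mathcomp Require Import all_classical all_reals all_analysis.
From mathcomp Require Import ring lra.
Import Order.TTheory GRing.Theory Num.Theory.
Import numFieldNormedType.Exports.
Local Open Scope classical_set_scope.
Local Open Scope ring_scope.

(** Node 4 sees a multiple-access channel with outputs [f a + u] and
    [f a + g b + v], where [u] and [v] are independent BSC noises with parameters
    [p14] and [p'], and [u + v] is a BSC noise with parameter [p''].  By Chebyshev's
    inequality [u], [v] and [u + v] are jointly typical with high probability, i.e.
    each has probability [2^(-n H)] up to a factor [2^(n eps)].
    Converse: the density of typical noises bounds the mass of correctly decoded
    outputs by the number of outputs; when [b] is known, [u + v] is read off the
    outputs, so that only [2^(n (1 + H(p'')))] outputs matter.
    Achievability: uniformly random codes with joint typicality decoding.  If only
    [a] is mistaken, both noises are shifted by the same uniform word, which keeps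
    [u + v] fixed, and only [2^(n (H(p14) + H(p') - H(p'')))] typical pairs have a
    given sum.
    The bounds are convex and closed, and scaling a point by [1 - t] makes every
    constraint strict except those on a zero rate, for which there is nothing to
    decode. *)

(** * Noise words and typicality *)

Lemma wxorC {n} : commutative (@wxor n).
Proof. by move=> x y; apply/ffunP => i; rewrite !ffunE addbC. Qed.

Lemma wxorA {n} : associative (@wxor n).
Proof. by move=> x y z; apply/ffunP => i; rewrite !ffunE addbA. Qed.

Lemma wxorK {n} (x : word n) : involutive (wxor x).
Proof. by move=> y; apply/ffunP => i; rewrite !ffunE addKb. Qed.

Lemma wxor_inj {n} (x : word n) : injective (wxor x).
Proof. exact: inv_inj (wxorK x). Qed.

Lemma sum_wxor {R : realType} {n} (x : word n) (F : word n -> R) :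
  \sum_u F (wxor x u) = \sum_u F u.
Proof. by rewrite [RHS](reindex_inj (wxor_inj x)). Qed.

Lemma sum_word_cst {R : realType} {n} (c : R) : \sum_(u : word n) c = 2 ^+ n * c.
Proof.
by rewrite sumr_const card_ffun card_bool card_ord -[LHS]mulr_natl natrX.
Qed.

Definition bern {R : realType} (p : R) (x : bool) : R := if x then p else 1 - p.

(** Crossover probability of two BSCs in cascade: two independent noise bits have sum 1 with this
    probability. *)
Definition bconv {R : realType} (p q : R) : R := p * (1 - q) + (1 - p) * q.

Lemma bern_ge0 {R : realType} {p : R} x : 0 <= p <= 1 -> 0 <= bern p x.
Proof. by case: x => /= /andP[]; rewrite ?subr_ge0. Qed.

Lemma bconv01 {R : realType} {p q : R} :
  0 <= p <= 1 -> 0 <= q <= 1 -> 0 <= bconv p q <= 1.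
Proof. by rewrite /bconv => /andP[? ?] /andP[? ?]; apply/andP; split; nra. Qed.

Lemma noise_ge0 {R : realType} {p : R} {n} (u : word n) :
  0 <= p <= 1 -> 0 <= bsc_noise_prob p u.
Proof. by move=> hp; apply: prodr_ge0 => i _; exact: bern_ge0. Qed.

Lemma sum_prod_bool {R : realType} {n} (F : 'I_n -> bool -> R) :
  \sum_(u : word n) \prod_i F i (u i) = \prod_i (F i true + F i false).
Proof.
rewrite -bigA_distr_bigA /=; apply: eq_bigr => i _.
by rewrite big_bool.
Qed.

Lemma sum_noise {R : realType} (p : R) n :
  \sum_(u : word n) bsc_noise_prob p u = 1.
Proof.
rewrite (sum_prod_bool (fun _ => bern p)) /=.
by rewrite big1 // => i _; rewrite addrC subrK.
Qed.

(** Both laws are products over the coordinates, so the convolution factors and reduces to a single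
    bit. *)
Lemma noise_conv {R : realType} (p q : R) {n} (s : word n) :
  \sum_u bsc_noise_prob p u * bsc_noise_prob q (wxor u s) =
  bsc_noise_prob (bconv p q) s.
Proof.
under eq_bigr => u _ do rewrite -big_split /=.
under eq_bigr => u _ do under eq_bigr => i _ do rewrite ffunE.
rewrite (sum_prod_bool (fun i x => bern p x * bern q (x (+) s i))).
by apply: eq_bigr => i _; case: (s i) => /=; rewrite /bconv; ring.
Qed.

Lemma sum_noise_conv {R : realType} (p q : R) {n} (F : word n -> R) :
  \sum_u \sum_v bsc_noise_prob p u * bsc_noise_prob q v * F (wxor u v) =
  \sum_s bsc_noise_prob (bconv p q) s * F s.
Proof.
under eq_bigr => u _ do rewrite -(sum_wxor u).
rewrite exchange_big /=; apply: eq_bigr => s _.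
rewrite -noise_conv mulr_suml; apply: eq_bigr => u _.
by rewrite wxorK.
Qed.

(** Variance of a sum of independent centred variables: the cross terms vanish. *)
Lemma noise_second_moment {R : realType} (p : R) {n} (phi : bool -> R) :
  p * phi true + (1 - p) * phi false = 0 ->
  \sum_(u : word n) bsc_noise_prob p u * (\sum_i phi (u i)) ^+ 2 =
  n%:R * (p * phi true ^+ 2 + (1 - p) * phi false ^+ 2).
Proof.
move=> phi0.
(* For fixed [i] and [j] the summand is a product over the coordinates [k], with one factor [phi] at
   [k = i] and one at [k = j]. *)
pose F (i j k : 'I_n) x := bern p x * (if k == i then phi x else 1) *
  (if k == j then phi x else 1).
have FE i j : \sum_(u : word n) bsc_noise_prob p u * (phi (u i) * phi (u j)) =
    (i == j)%:R * (p * phi true ^+ 2 + (1 - p) * phi false ^+ 2).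
  transitivity (\sum_(u : word n) \prod_k F i j k (u k)).
    apply: eq_bigr => u _; rewrite !big_split /= -mulrA; congr (_ * (_ * _)).
      by rewrite (bigD1 i) //= eqxx big1 ?mulr1 // => k /negPf ->.
    by rewrite (bigD1 j) //= eqxx big1 ?mulr1 // => k /negPf ->.
  rewrite sum_prod_bool (bigD1 i) //= /F eqxx.
  case: (eqVneq i j) => [<-|ij]; last first.
    by rewrite !mulr1 /= phi0 !mul0r.
  rewrite big1 ?mulr1 => [|k /negPf ->] /=; last by ring.
  by rewrite mul1r; ring.
transitivity (\sum_(i < n) \sum_(j < n)
    \sum_(u : word n) bsc_noise_prob p u * (phi (u i) * phi (u j))).
  rewrite exchange_big /= [in RHS]exchange_big /=.
  under [RHS]eq_bigr => i _ do rewrite exchange_big /=.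
  rewrite exchange_big /=; apply: eq_bigr => u _.
  rewrite expr2 mulr_sumr mulr_sumr exchange_big; apply: eq_bigr => i _.
  by rewrite mulr_suml mulr_sumr.
rewrite mulr_natl -[in RHS](card_ord n) -sumr_const; apply: eq_bigr => i _.
under eq_bigr => j _ do rewrite FE.
rewrite (bigD1 i) //= eqxx mul1r big1 ?addr0 // => j /negPf.
by rewrite eq_sym => ->; rewrite mul0r.
Qed.

Lemma powR2_log2 {R : realType} (x : R) : 0 < x -> 2 `^ log2 x = x.
Proof.
move=> x0; rewrite /log2 /powR pnatr_eq0 /= divfK ?lnK //.
by rewrite gt_eqF // ln_gt0 // ltr1n.
Qed.

Lemma powR2D {R : realType} (x y : R) : 2 `^ (x + y) = 2 `^ x * 2 `^ y.
Proof. by rewrite powRD // pnatr_eq0 implybT. Qed.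

Lemma powR2_sum {R : realType} {n} (F : 'I_n -> R) :
  2 `^ (\sum_i F i) = \prod_i 2 `^ F i.
Proof.
by apply: (big_morph (fun x : R => 2 `^ x)) => [x y|]; rewrite ?powRr0 ?powR2D.
Qed.

Lemma powR2_lt {R : realType} (x y : R) : (2 `^ x < 2 `^ y) = (x < y).
Proof.
rewrite /powR pnatr_eq0 /= ltr_expR ltr_pM2r //.
by rewrite ln_gt0 // ltr1n.
Qed.

Lemma powR2_le {R : realType} (x y : R) : (2 `^ x <= 2 `^ y) = (x <= y).
Proof. by rewrite !leNgt powR2_lt. Qed.

(* Entropy typicality; words of probability [0] are atypical. *)
Definition typical {R : realType} (p eps : R) {n} (u : word n) : bool :=
  (2 `^ (- (n%:R * (Hb p + eps))) <= bsc_noise_prob p u)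
  && (bsc_noise_prob p u <= 2 `^ (- (n%:R * (Hb p - eps)))).

(** Chebyshev's inequality for the log-likelihood of [u]; the constant does not depend on [n]. *)
Lemma noise_atypical {R : realType} (p eps : R) :
  0 <= p <= 1 -> 0 < eps -> exists V : R, forall n : nat, (0 < n)%N ->
  \sum_(u : word n) bsc_noise_prob p u * (~~ typical p eps u)%:R <= V / n%:R.
Proof.
move=> hp eps0.
(* Centred log-likelihood of one bit: its mean is 0 by the definition of entropy, and for [p] equal
   to 0 or 1 the value of [log2 0] has weight 0. *)
pose phi x := log2 (bern p x) + Hb p.
have phi0 : p * phi true + (1 - p) * phi false = 0.
  by rewrite /phi /Hb /=; ring.
pose V := p * phi true ^+ 2 + (1 - p) * phi false ^+ 2.
exists (V / eps ^+ 2) => n n0.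
have nn0 : 0 < n%:R :> R by rewrite ltr0n.
have -> : V / eps ^+ 2 / n%:R = (n%:R * V) / (n%:R * eps) ^+ 2.
  by field; rewrite !gt_eqF.
rewrite /V -noise_second_moment // ler_pdivlMr ?exprn_gt0 ?mulr_gt0 //.
rewrite mulr_suml; apply: ler_sum => u _.
have := noise_ge0 u hp; rewrite le_eqVlt => /orP[/eqP <-|Bu].
  by rewrite !mul0r.
rewrite -mulrA ler_pM2l //.
case: (boolP (typical p eps u)) => [_|]; first by rewrite mul0r sqr_ge0.
(* At positive probability no factor vanishes, so atypicality says that the sum of [phi] exceeds
   [n * eps] in absolute value. *)
have BE : bsc_noise_prob p u = 2 `^ (\sum_i phi (u i) - n%:R * Hb p).
  rewrite big_split /= sumr_const card_ord -[X in _ + X - _]mulr_natl addrK.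
  rewrite powR2_sum; apply: eq_bigr => i _; rewrite powR2_log2 //.
  rewrite lt_neqAle bern_ge0 // andbT eq_sym.
  by move: (lt0r_neq0 Bu); rewrite prodf_seq_neq0 => /allP/(_ i); rewrite mem_index_enum => /(_ isT).
rewrite /typical BE !powR2_le negb_and -!ltNge mul1r.
set S := \sum_i _; have c0 : 0 < n%:R * eps by rewrite mulr_gt0.
rewrite -(real_normK (num_real S)) ler_sqr ?nnegrE ?(ltW c0) //.
rewrite ler_normr => /orP[] h; apply/orP; [right|left]; lra.
Qed.

(** * The multiple-access channel at node 4 *)

Lemma pow2_powR {R : realType} (n : nat) : 2 ^+ n = 2 `^ n%:R :> R.
Proof. by rewrite powR_mulrn. Qed.

(** [F] sees [e13], [e23] and [e34] only through their sum, which is again BSC noise. *)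
Lemma sum_noise4 {R : realType} (p13 p14 p23 p34 : R) {n}
    (F : word n -> word n -> R) :
  \sum_e13 \sum_e23 \sum_e14 \sum_e34
    bsc_noise_prob p13 e13 * bsc_noise_prob p23 e23 *
    bsc_noise_prob p14 e14 * bsc_noise_prob p34 e34 *
    F e14 (wxor (wxor e13 e23) e34) =
  \sum_u \sum_v bsc_noise_prob p14 u *
    bsc_noise_prob (bconv (bconv p13 p23) p34) v * F u v.
Proof.
under eq_bigr => e13 _ do rewrite exchange_big /=.
rewrite exchange_big /=; apply: eq_bigr => u _.
under [RHS]eq_bigr => v _ do rewrite -mulrA.
rewrite -mulr_sumr -sum_noise_conv.
under [in RHS]eq_bigr => s _ do under eq_bigr => e _ do rewrite -mulrA.
under [in RHS]eq_bigr => s _ do rewrite -mulr_sumr.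
rewrite -(sum_noise_conv p13 p23) mulr_sumr.
apply: eq_bigr => e13 _; rewrite mulr_sumr; apply: eq_bigr => e23 _.
rewrite !mulr_sumr; apply: eq_bigr => e34 _; ring.
Qed.

Lemma p_primeE {R : realType} (p13 p23 p34 : R) :
  p_prime p13 p23 p34 = bconv (bconv p13 p23) p34.
Proof. by rewrite /p_prime /bconv; ring. Qed.

(** The eight terms of [p_second] are the patterns of the four noise bits with an odd number of
    ones. *)
Lemma p_secondE {R : realType} (p13 p14 p23 p34 : R) :
  p_second p13 p14 p23 p34 = bconv p14 (p_prime p13 p23 p34).
Proof. by rewrite /p_second /p_prime /bconv; ring. Qed.

Definition mac_err {R : realType} (p q : R) {n MA MB : nat}
    (f : 'I_MA -> word n) (g : 'I_MB -> word n)
    (dec : word n -> word n -> 'I_MA * 'I_MB) : R :=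
  (MA%:R * MB%:R)^-1 * \sum_a \sum_b \sum_u \sum_v
    bsc_noise_prob p u * bsc_noise_prob q v *
    (dec (wxor (f a) u) (wxor (wxor (f a) (g b)) v) != (a, b))%:R.

Lemma err_prob_mac {R : realType} (p13 p14 p23 p34 : R) {n MA MB : nat}
    (f : 'I_MA -> word n) (g : 'I_MB -> word n)
    (dec : word n -> word n -> 'I_MA * 'I_MB) :
  err_prob p13 p14 p23 p34 f g dec = mac_err p14 (p_prime p13 p23 p34) f g dec.
Proof.
rewrite /err_prob /mac_err p_primeE; congr (_ * _).
apply: eq_bigr => a _; apply: eq_bigr => b _.
rewrite -(sum_noise4 p13 p14 p23 p34 (fun u v =>
  (dec (wxor (f a) u) (wxor (wxor (f a) (g b)) v) != (a, b))%:R)).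
do 4 ![apply: eq_bigr => ? _]; congr (_ * (dec _ _ != _)%:R).
by apply/ffunP => i; rewrite !ffunE; do !case: (_ i).
Qed.

Lemma sum_noise_pair {R : realType} (p q : R) n :
  \sum_(u : word n) \sum_(v : word n)
    bsc_noise_prob p u * bsc_noise_prob q v = 1.
Proof.
under eq_bigr => u _ do rewrite -mulr_sumr sum_noise mulr1.
exact: sum_noise.
Qed.

Lemma typical_ge {R : realType} (p eps : R) {n} (u : word n) :
  typical p eps u -> 1 <= bsc_noise_prob p u * 2 `^ (n%:R * (Hb p + eps)).
Proof.
by case/andP => + _; rewrite powRN -[X in X <= _ -> _]mul1r ler_pdivrMr ?powR_gt0.
Qed.

(** Each typical word has probability at least [2^(-n (H(p) + eps))], and the probabilities sum to
    1. *)
Lemma sum_typical {R : realType} (p eps : R) n : 0 <= p <= 1 ->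
  \sum_(u : word n) (typical p eps u)%:R <= 2 `^ (n%:R * (Hb p + eps)).
Proof.
move=> hp.
rewrite -[leRHS]mulr1 -[X in _ * X](sum_noise p n) mulr_sumr.
apply: ler_sum => u _.
case: (boolP (typical p eps u)) => [/typical_ge|_]; first by rewrite mulrC.
by rewrite mulr_ge0 ?powR_ge0 ?noise_ge0.
Qed.

(** Typicality of the sum is what brings in [C''], both in the converse with [b] known and for
    errors in [a] alone. *)
Definition jtypical {R : realType} (p q eps : R) {n} (u v : word n) : bool :=
  [&& typical p eps u, typical q eps v & typical (bconv p q) eps (wxor u v)].

(** Union bound over the three conditions, the sum [u + v] being noise of parameter [bconv p q]. *)
Lemma noise_jatypical {R : realType} (p q eps delta : R) :
  0 <= p <= 1 -> 0 <= q <= 1 -> 0 < eps -> 0 < delta ->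
  exists N : nat, forall n : nat, (N <= n)%N ->
  \sum_(u : word n) \sum_(v : word n) bsc_noise_prob p u * bsc_noise_prob q v *
    (~~ jtypical p q eps u v)%:R <= delta.
Proof.
move=> hp hq eps0 delta0.
have [V1 hV1] := noise_atypical p eps hp eps0.
have [V2 hV2] := noise_atypical q eps hq eps0.
have [V3 hV3] := noise_atypical _ eps (bconv01 hp hq) eps0.
pose V := V1 + V2 + V3.
(* [V / n <= delta] once [n >= V / delta]; the successor also makes [n] positive. *)
exists (Num.truncn (V / delta)).+1 => n Nn.
have n0 : (0 < n)%N by apply: leq_trans Nn.
have nn0 : 0 < n%:R :> R by rewrite ltr0n.
apply: (@le_trans _ _ (V / n%:R)); last first.
  rewrite ler_pdivrMr // mulrC -ler_pdivrMr //.
  by rewrite (le_trans (ltW (truncnS_gt _))) // ler_nat.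
rewrite /V !mulrDl.
apply: le_trans (lerD (lerD (hV1 n n0) (hV2 n n0)) (hV3 n n0)).
rewrite -sum_noise_conv.
have -> : \sum_(u : word n) bsc_noise_prob q u * (~~ typical q eps u)%:R =
    \sum_(u : word n) \sum_(v : word n) bsc_noise_prob p u * bsc_noise_prob q v
      * (~~ typical q eps v)%:R.
  under [RHS]eq_bigr => u _ do under eq_bigr => v _ do rewrite -mulrA.
  under [RHS]eq_bigr => u _ do rewrite -mulr_sumr.
  by rewrite -mulr_suml sum_noise mul1r.
have -> : \sum_(u : word n) bsc_noise_prob p u * (~~ typical p eps u)%:R =
    \sum_(u : word n) \sum_(v : word n) bsc_noise_prob p u * bsc_noise_prob q v
      * (~~ typical p eps u)%:R.
  apply: eq_bigr => u _; rewrite -mulr_suml -mulr_sumr sum_noise.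
  by rewrite mulr1.
rewrite -!big_split; apply: ler_sum => u _.
rewrite -!big_split; apply: ler_sum => v _ /=.
rewrite -!mulrDr; apply: ler_wpM2l; first by rewrite mulr_ge0 ?noise_ge0.
rewrite -!natrD ler_nat /jtypical.
by case: (typical p) => /=; case: (typical q) => /=; case: (typical _).
Qed.

(** A jointly typical pair has probability at least [1 / c], while all pairs with sum [s] have
    together the probability of [s], which is small if [s] is typical. If [s] is atypical, no pair
    counts. *)
Lemma sum_jtypical_fiber {R : realType} (p q eps : R) n (s : word n) :
  0 <= p <= 1 -> 0 <= q <= 1 ->
  \sum_w (jtypical p q eps w (wxor w s))%:R <=
  2 `^ (n%:R * (Hb p + Hb q - Hb (bconv p q) + 3 * eps)).
Proof.
move=> hp hq.
pose c := 2 `^ (n%:R * (Hb p + eps)) * 2 `^ (n%:R * (Hb q + eps)).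
have c0 : 0 < c by rewrite mulr_gt0 ?powR_gt0.
have [ts|/negPf nts] := boolP (typical (bconv p q) eps s); last first.
  rewrite big1 ?powR_ge0 // => w _.
  by rewrite /jtypical wxorK nts !andbF.
apply: (@le_trans _ _ (c * bsc_noise_prob (bconv p q) s)); last first.
  case/andP: ts => _; rewrite -(ler_pM2l c0) => /le_trans; apply.
  by rewrite /c -!powR2D powR2_le le_eqVlt; apply/orP; left; apply/eqP; ring.
rewrite -noise_conv mulr_sumr; apply: ler_sum => w _.
case: (boolP (jtypical _ _ _ _ _)) => [|_]; last first.
  by rewrite mulr_ge0 ?(ltW c0) // mulr_ge0 ?noise_ge0.
case/and3P => /typical_ge h1 /typical_ge h2 _.
rewrite -[leLHS]mulr1 /c.
apply: le_trans (ler_pM _ _ h1 h2) _ => //.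
by rewrite le_eqVlt; apply/orP; left; apply/eqP; ring.
Qed.

(** * Counting bounds for the converse *)

(* Not normalized: [MA * MB] times the probability of a jointly typical noise and
   a correct decoding. *)
Definition mac_good {R : realType} (p q eps : R) {n MA MB : nat}
    (f : 'I_MA -> word n) (g : 'I_MB -> word n)
    (dec : word n -> word n -> 'I_MA * 'I_MB) : R :=
  \sum_a \sum_b \sum_u \sum_v bsc_noise_prob p u * bsc_noise_prob q v *
    (jtypical p q eps u v &&
     (dec (wxor (f a) u) (wxor (wxor (f a) (g b)) v) == (a, b)))%:R.

(** For each message pair, every noise pair is atypical, wrongly decoded or counted in
    [mac_good]. *)
Lemma mac_err_good {R : realType} (p q eps delta : R) {n MA MB : nat}
    (f : 'I_MA -> word n) (g : 'I_MB -> word n)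
    (dec : word n -> word n -> 'I_MA * 'I_MB) :
  (0 < MA)%N -> (0 < MB)%N -> 0 <= p <= 1 -> 0 <= q <= 1 ->
  \sum_(u : word n) \sum_(v : word n) bsc_noise_prob p u * bsc_noise_prob q v *
    (~~ jtypical p q eps u v)%:R <= delta ->
  (1 - mac_err p q f g dec - delta) * (MA%:R * MB%:R) <=
  mac_good p q eps f g dec.
Proof.
move=> MA0 MB0 hp hq hdelta.
have M0 : 0 < MA%:R * MB%:R :> R by rewrite mulr_gt0 ?ltr0n.
rewrite !mulrBl mul1r /mac_err mulrAC mulVf ?gt_eqF // mul1r lerBlDr lerBlDr.
have cst (c : R) : \sum_(a < MA) \sum_(b < MB) c = c * (MA%:R * MB%:R).
  rewrite sumr_const sumr_const !card_ord -mulrnA -[LHS]mulr_natr natrM.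
  by rewrite [in RHS](mulrC MA%:R).
rewrite -cst -[X in X <= _]mul1r -cst -!big_split.
apply: ler_sum => a _; rewrite -!big_split; apply: ler_sum => b _ /=.
rewrite -[X in X <= _](sum_noise_pair p q n).
rewrite addrAC; apply: le_trans (lerD (lexx _) hdelta).
rewrite -!big_split; apply: ler_sum => u _.
rewrite -!big_split; apply: ler_sum => v _ /=.
rewrite -!mulrDr -[leLHS]mulr1.
apply: ler_wpM2l; first by rewrite mulr_ge0 ?noise_ge0.
rewrite -!natrD (ler_nat R 1).
by case: (jtypical _ _ _ _ _); case: (_ == _).
Qed.

Lemma sum_ind_le {R : realType} {I : finType} (P : pred I) :
  (forall x y, P x -> P y -> x = y) -> \sum_x (P x)%:R <= 1 :> R.
Proof.
move=> Puniq; case: (pickP P) => [x Px|P0]; last first.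
  by rewrite big1 // => x _; rewrite P0.
rewrite (bigD1 x) //= Px big1 ?addr0 // => y; apply: contraNeq => nz.
apply/eqP/Puniq => //; apply: contraNT nz => /negPf ->.
by [].
Qed.

Lemma sum_fst_le {R : realType} {I J : finType} (z : I * J) b :
  \sum_a (z == (a, b))%:R <= 1 :> R.
Proof. by apply: sum_ind_le => x y /eqP -> /eqP[]. Qed.

Lemma sum_snd_le {R : realType} {I J : finType} (z : I * J) a :
  \sum_b (z == (a, b))%:R <= 1 :> R.
Proof. by apply: sum_ind_le => x y /eqP -> /eqP[]. Qed.

Lemma sum_pair_le {R : realType} {I J : finType} (z : I * J) :
  \sum_a \sum_b (z == (a, b))%:R <= 1 :> R.
Proof.
rewrite pair_big /=; apply: sum_ind_le => -[x1 x2] [y1 y2] /=.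
by move=> /eqP -> /eqP.
Qed.

Lemma typical_le {R : realType} (p eps : R) {n} (u : word n) :
  typical p eps u -> bsc_noise_prob p u <= 2 `^ (- (n%:R * (Hb p - eps))).
Proof. by case/andP. Qed.

(** For fixed codewords, noise pairs and output pairs correspond bijectively. *)
Lemma sum_mac_outputs {R : realType} {n} (x y : word n)
    (F : word n -> word n -> R) :
  \sum_u \sum_v F (wxor x u) (wxor (wxor x y) v) = \sum_u \sum_v F u v.
Proof.
rewrite -[RHS](sum_wxor x); apply: eq_bigr => u _.
by rewrite -[RHS](sum_wxor (wxor x y)).
Qed.

(** Typical noise pairs have density at most [c], and each of the [4^n] output pairs is decoded to
    one message pair. *)
Lemma mac_good_sum {R : realType} (p q eps : R) {n MA MB : nat}
    (f : 'I_MA -> word n) (g : 'I_MB -> word n)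
    (dec : word n -> word n -> 'I_MA * 'I_MB) :
  0 <= p <= 1 -> 0 <= q <= 1 ->
  mac_good p q eps f g dec <=
  2 `^ (n%:R * ((1 - Hb p) + (1 - Hb q) + 2 * eps)).
Proof.
move=> hp hq.
pose c : R := 2 `^ (- (n%:R * (Hb p - eps))) * 2 `^ (- (n%:R * (Hb q - eps))).
have c0 : 0 <= c by rewrite mulr_ge0 ?powR_ge0.
have -> : 2 `^ (n%:R * ((1 - Hb p) + (1 - Hb q) + 2 * eps)) =
    c * (2 ^+ n * (2 ^+ n * 1)).
  by rewrite /c pow2_powR mulr1 -!powR2D; congr (_ `^ _); ring.
rewrite -!sum_word_cst.
apply: (@le_trans _ _ (c * \sum_a \sum_b \sum_u \sum_v
    (dec (wxor (f a) u) (wxor (wxor (f a) (g b)) v) == (a, b))%:R)).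
  rewrite /mac_good; do 4 ![rewrite mulr_sumr; apply: ler_sum => ? _].
  case: (boolP (jtypical _ _ _ _ _)) => [|_]; last by rewrite mulr0 mulr_ge0.
  case/and3P => /typical_le h1 /typical_le h2 _ /=.
  by apply: ler_wpM2r => //; apply: ler_pM => //; exact: noise_ge0.
apply: ler_wpM2l => //.
under eq_bigr => a _ do under eq_bigr => b _ do
  rewrite (sum_mac_outputs (f a) (g b) (fun u v => (dec u v == (a, b))%:R)).
under eq_bigr => a _ do rewrite exchange_big /=.
rewrite exchange_big; apply: ler_sum => u _ /=.
under eq_bigr => a _ do rewrite exchange_big /=.
rewrite exchange_big; apply: ler_sum => v _ /=.
exact: sum_pair_le.
Qed.

(** With [a] and [u] fixed, a typical [v] has density at most [c], and each of the [2^n] second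
    outputs is decoded to at most one [b]. *)
Lemma mac_good_snd {R : realType} (p q eps : R) {n MA MB : nat}
    (f : 'I_MA -> word n) (g : 'I_MB -> word n)
    (dec : word n -> word n -> 'I_MA * 'I_MB) :
  0 <= p <= 1 -> 0 <= q <= 1 ->
  mac_good p q eps f g dec <= MA%:R * 2 `^ (n%:R * ((1 - Hb q) + eps)).
Proof.
move=> hp hq.
pose c : R := 2 `^ (- (n%:R * (Hb q - eps))).
have c0 : 0 <= c by rewrite powR_ge0.
have -> : 2 `^ (n%:R * ((1 - Hb q) + eps)) = c * 2 ^+ n.
  by rewrite /c pow2_powR -!powR2D; congr (_ `^ _); ring.
rewrite -[MA in leRHS]card_ord mulr_natl -sumr_const.
apply: ler_sum => a _; rewrite exchange_big -[leRHS]mul1r -[X in _ <= X * _](sum_noise p n).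
rewrite mulr_suml; apply: ler_sum => u _ /=.
apply: (@le_trans _ _ (bsc_noise_prob p u * (c * \sum_b \sum_v
    (dec (wxor (f a) u) (wxor (wxor (f a) (g b)) v) == (a, b))%:R))).
  do 2 ![rewrite !mulr_sumr; apply: ler_sum => ? _].
  rewrite -mulrA; apply: ler_wpM2l; first exact: noise_ge0.
  case: (boolP (jtypical _ _ _ _ _)) => [|_]; last by rewrite mulr0 mulr_ge0.
  case/and3P => _ /typical_le h2 _ /=.
  exact: ler_wpM2r.
apply: ler_wpM2l; first exact: noise_ge0.
apply: ler_wpM2l => //.
under eq_bigr => b _ do rewrite (sum_wxor (wxor (f a) (g b))
  (fun v => (dec (wxor (f a) u) v == (a, b))%:R)).
rewrite exchange_big -[leRHS]mulr1 -sum_word_cst; apply: ler_sum => v _.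
exact: sum_snd_le.
Qed.

(** With [b] fixed, the outputs determine [u + v], so each of the [2^n] first outputs leaves at most
    [2^(n (H(bconv p q) + eps))] second ones; each output pair is decoded to at most one [a]. *)
Lemma mac_good_fst {R : realType} (p q eps : R) {n MA MB : nat}
    (f : 'I_MA -> word n) (g : 'I_MB -> word n)
    (dec : word n -> word n -> 'I_MA * 'I_MB) :
  0 <= p <= 1 -> 0 <= q <= 1 ->
  mac_good p q eps f g dec <=
  MB%:R * 2 `^ (n%:R * ((1 - Hb p) + (1 - Hb q) - (1 - Hb (bconv p q)) + 3 * eps)).
Proof.
move=> hp hq.
pose c : R := 2 `^ (- (n%:R * (Hb p - eps))) * 2 `^ (- (n%:R * (Hb q - eps))).
have c0 : 0 <= c by rewrite mulr_ge0 ?powR_ge0.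
have -> : 2 `^ (n%:R * ((1 - Hb p) + (1 - Hb q) - (1 - Hb (bconv p q)) + 3 * eps))
    = c * (2 ^+ n * 2 `^ (n%:R * (Hb (bconv p q) + eps))).
  by rewrite /c pow2_powR -!powR2D; congr (_ `^ _); ring.
rewrite -[MB in leRHS]card_ord mulr_natl -sumr_const /mac_good exchange_big.
apply: ler_sum => b _ /=.
(* Typicality of [u + v], expressed through the outputs [y], [z] and the known [g b]. *)
pose T y z : R := (typical (bconv p q) eps (wxor (wxor y z) (g b)))%:R.
apply: (@le_trans _ _ (c * \sum_a \sum_u \sum_v
    T (wxor (f a) u) (wxor (wxor (f a) (g b)) v) *
    (dec (wxor (f a) u) (wxor (wxor (f a) (g b)) v) == (a, b))%:R)).
  rewrite mulr_sumr; apply: ler_sum => a _.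
  rewrite mulr_sumr; apply: ler_sum => u _.
  rewrite mulr_sumr; apply: ler_sum => v _.
  case: (boolP (jtypical _ _ _ _ _)) => [|_]; last first.
    by rewrite mulr0 !mulr_ge0.
  case/and3P => /typical_le h1 /typical_le h2 h3 /=.
  rewrite mulrA; apply: ler_wpM2r => //.
  rewrite -[leLHS]mulr1; apply: ler_pM => //.
  - by rewrite mulr_ge0 ?noise_ge0.
  - by apply: ler_pM => //; exact: noise_ge0.
  rewrite /T; set t := (X in typical _ _ X).
  suff -> : t = wxor u v by rewrite h3.
  by apply/ffunP => k; rewrite !ffunE; do !case: (_ k).
apply: ler_wpM2l => //.
under eq_bigr => a _ do rewrite (sum_mac_outputs (f a) (g b)
  (fun u v => T u v * (dec u v == (a, b))%:R)).
rewrite exchange_big -sum_word_cst; apply: ler_sum => u _ /=.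
rewrite exchange_big /=; apply: le_trans (sum_typical _ eps n (bconv01 hp hq)).
rewrite -[leRHS](sum_wxor (wxor u (g b))); apply: ler_sum => v _.
rewrite -mulr_sumr -[leRHS]mulr1; apply: ler_pM; rewrite ?sumr_ge0 //.
  rewrite /T; set t := (X in typical _ _ X).
  suff -> : t = wxor (wxor u (g b)) v by [].
  by apply/ffunP => k; rewrite !ffunE; do !case: (_ k).
exact: sum_fst_le.
Qed.

(** * Random coding *)

Lemma exists_le_mean {R : realType} {I : finType} (i0 : I) (F : I -> R) (c : R) :
  \sum_i F i <= #|I|%:R * c -> exists i, F i <= c.
Proof.
move=> Fc; apply: contrapT => /forallNP nF; move: Fc; apply/negP.
rewrite -ltNge mulr_natl -sumr_const; apply: ltr_sum.
  by apply/hasP; exists i0; rewrite ?mem_index_enum.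
by move=> i _; rewrite ltNge; apply/negP/nF.
Qed.

(* Translating [f a] by a fixed word is a bijection on the codes, so the average
   over codes of a function of [f a + f a'] is its average over all words. *)
Lemma sum_random_code {R : realType} {n M : nat} (a a' : 'I_M)
    (K : word n -> R) : a' != a ->
  \sum_(f : {ffun 'I_M -> word n}) K (wxor (f a) (f a')) =
  #|{ffun 'I_M -> word n}|%:R * (2 ^- n * \sum_d K d).
Proof.
move=> aa'.
pose sh (d : word n) (f : {ffun 'I_M -> word n}) : {ffun 'I_M -> word n} :=
  [ffun i => if i == a then wxor d (f i) else f i].
have shK d : involutive (sh d).
  by move=> f; apply/ffunP => i; rewrite ffunE; case: ifP => ia; rewrite ffunE ia ?wxorK.
have two0 : 2 ^+ n != 0 :> R by rewrite expf_neq0 // pnatr_eq0.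
(* Multiplied by [2^n], the left side becomes a sum over all translations [d], each of which leaves
   it invariant. *)
rewrite mulrCA; apply: (mulfI two0); rewrite mulVKf //.
rewrite -sum_word_cst -sumr_const mulr_suml.
under eq_bigr => d _ do rewrite (reindex_inj (inv_inj (shK d))) /=.
rewrite exchange_big; apply: eq_bigr => f _ /=; rewrite mul1r.
under eq_bigr => d _ do rewrite !ffunE eqxx (negPf aa') -wxorA wxorC.
exact: sum_wxor.
Qed.

(** Any jointly typical candidate is accepted, with no uniqueness test; [z0] is the default when
    there is none. *)
Definition jdecode {R : realType} (p q eps : R) {n MA MB : nat}
    (z0 : 'I_MA * 'I_MB) (f : 'I_MA -> word n) (g : 'I_MB -> word n)
    (y1 y2 : word n) : 'I_MA * 'I_MB :=
  odflt z0 [pick z | jtypical p q eps (wxor (f z.1) y1)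
                                      (wxor (wxor (f z.1) (g z.2)) y2)].

(** Union bound: on an error either the true noise is atypical, or the noise implied by a wrong pair
    is jointly typical. The latter is the true noise shifted by differences of codewords. *)
Lemma jdecode_err {R : realType} (p q eps : R) {n MA MB : nat}
    (z0 : 'I_MA * 'I_MB) (f : 'I_MA -> word n) (g : 'I_MB -> word n) a b
    (u v : word n) (T := @jtypical R p q eps n) :
  (jdecode p q eps z0 f g (wxor (f a) u) (wxor (wxor (f a) (g b)) v)
    != (a, b))%:R <=
  (~~ T u v)%:R
  + \sum_(b' | b' != b) (T u (wxor v (wxor (g b) (g b'))))%:R
  + \sum_(a' | a' != a)
      (T (wxor u (wxor (f a) (f a'))) (wxor v (wxor (f a) (f a'))))%:R
  + \sum_(a' | a' != a) \sum_(b' | b' != b)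
      (T (wxor u (wxor (f a) (f a')))
         (wxor (wxor v (wxor (f a) (f a'))) (wxor (g b) (g b'))))%:R :> R.
Proof.
set s1 := \sum_(b' | _) _; set s2 := \sum_(a' | _) _; set s3 := \sum_(a' | _) _.
have s10 : 0 <= s1 by apply: sumr_ge0.
have s20 : 0 <= s2 by apply: sumr_ge0.
have s30 : 0 <= s3 by apply: sumr_ge0 => i _; apply: sumr_ge0.
rewrite /jdecode; case: pickP => [[a' b'] /= Tz|noT] /=; last first.
  have : ~~ T u v.
    apply/negP => Tuv; have := noT (a, b); rewrite /= !wxorK.
    by move: Tuv; rewrite /T => ->.
  by move=> -> ; case: (_ != _) => /=; lra.
have uE : wxor (f a') (wxor (f a) u) = wxor u (wxor (f a) (f a')).
  by apply/ffunP => k; rewrite !ffunE; do !case: (_ k).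
have vE : wxor (wxor (f a') (g b')) (wxor (wxor (f a) (g b)) v) =
    wxor (wxor v (wxor (f a) (f a'))) (wxor (g b) (g b')).
  by apply/ffunP => k; rewrite !ffunE; do !case: (_ k).
rewrite uE vE in Tz.
have Tuv0 : 0 <= (~~ T u v)%:R :> R by [].
(* The shift belonging to a correct message is trivial, which leaves the sum for the messages that
   are wrong. *)
have self m (w x : word m) : wxor w (wxor x x) = w.
  by apply/ffunP => k; rewrite !ffunE addbb addbF.
rewrite xpair_eqE negb_and.
have [ea|na] := eqVneq a' a; have [eb|nb] := eqVneq b' b => /=.
- by lra.
- rewrite ea !self in Tz.
  have : 1 <= s1 by rewrite /s1 (bigD1 b') //= {1}/T Tz lerDl sumr_ge0.
  by lra.
- rewrite eb self in Tz.
  have : 1 <= s2 by rewrite /s2 (bigD1 a') //= {1}/T Tz lerDl sumr_ge0.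
  by lra.
- have : 1 <= s3.
    rewrite /s3 (bigD1 a') //= (bigD1 b') //= {1}/T Tz -addrA lerDl addr_ge0 //.
      exact: sumr_ge0.
    by apply: sumr_ge0 => i _; apply: sumr_ge0.
  by lra.
Qed.

(* The three kinds of wrong messages.  The counts [M - 1] vanish at rate [0], where
   the exponent need not be negative. *)
Definition random_coding_bound {R : realType} (p q eps : R) (n MA MB : nat) : R :=
  MB.-1%:R * 2 `^ (- (n%:R * (1 - Hb q - eps)))
  + MA.-1%:R *
    2 `^ (- (n%:R * ((1 - Hb p) + (1 - Hb q) - (1 - Hb (bconv p q)) - 3 * eps)))
  + MA.-1%:R * MB.-1%:R *
    2 `^ (- (n%:R * ((1 - Hb p) + (1 - Hb q) - 2 * eps))).

(** Averaging over the codes makes every shift at a wrong message uniform, so each error term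
    becomes a count of typical words divided by the number of words. *)
Lemma sum_jdecode_err {R : realType} (p q eps : R) {n MA MB : nat}
    (z0 : 'I_MA * 'I_MB) a b (u v : word n) :
  0 <= p <= 1 -> 0 <= q <= 1 ->
  \sum_(f : {ffun 'I_MA -> word n}) \sum_(g : {ffun 'I_MB -> word n})
    (jdecode p q eps z0 f g (wxor (f a) u) (wxor (wxor (f a) (g b)) v)
    != (a, b))%:R <=
  #|{ffun 'I_MA -> word n}|%:R * #|{ffun 'I_MB -> word n}|%:R *
  ((~~ jtypical p q eps u v)%:R + random_coding_bound p q eps n MA MB).
Proof.
move=> hp hq; set NF : R := #|_|%:R; set NG : R := #|_|%:R.
apply: le_trans.
  apply: ler_sum => f _; apply: ler_sum => g _; exact: jdecode_err.
have cF (c : R) : \sum_(f : {ffun 'I_MA -> word n}) c = NF * c.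
  by rewrite sumr_const mulr_natl.
have cG (c : R) : \sum_(f : {ffun 'I_MB -> word n}) c = NG * c.
  by rewrite sumr_const mulr_natl.
have cA (c : R) : \sum_(a' | a' != a) c = MA.-1%:R * c.
  by rewrite sumr_const cardC1 card_ord mulr_natl.
have cB (c : R) : \sum_(b' | b' != b) c = MB.-1%:R * c.
  by rewrite sumr_const cardC1 card_ord mulr_natl.
have NF0 : 0 <= NF by [].
have NG0 : 0 <= NG by [].
have i20 : 0 <= 2 ^- n :> R by rewrite invr_ge0 exprn_ge0.
have i2E : 2 ^- n = 2 `^ (- n%:R) :> R by rewrite pow2_powR powRN.
under eq_bigr => f _ do rewrite !big_split /=.
rewrite !big_split /= /random_coding_bound.
set eB := 2 `^ _; set eA := 2 `^ _; set eAB := 2 `^ _.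
rewrite !mulrDr !addrA.
apply: lerD; first apply: lerD; first apply: lerD.
- by under eq_bigr => f _ do rewrite cG; rewrite cF mulrA.
(* Only [b] is wrong: [v] alone is shifted. *)
- rewrite cF -mulrA; apply: ler_wpM2l => //.
  rewrite exchange_big /= mulrCA -cB; apply: ler_sum => b' bb'.
  rewrite (sum_random_code b b' (fun d => (jtypical p q eps u (wxor v d))%:R)) //.
  apply: ler_wpM2l => //.
  have -> : eB = 2 ^- n * 2 `^ (n%:R * (Hb q + eps)).
    by rewrite /eB i2E -powR2D; congr (_ `^ _); ring.
  apply: ler_wpM2l => //; apply: le_trans (sum_typical _ _ _ hq).
  rewrite -[leRHS](sum_wxor v); apply: ler_sum => d _.
  by rewrite ler_nat; case: (boolP (jtypical _ _ _ _ _)) => // /and3P[_ ->].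
(* Only [a] is wrong: the common shift keeps the sum [u + v], so the fibre bound applies. *)
- under eq_bigr => f _ do rewrite cG.
  rewrite -mulr_sumr [NF * NG]mulrC -[leRHS]mulrA; apply: ler_wpM2l => //.
  rewrite exchange_big /= mulrCA -cA; apply: ler_sum => a' aa'.
  rewrite (sum_random_code a a'
    (fun d => (jtypical p q eps (wxor u d) (wxor v d))%:R)) //.
  apply: ler_wpM2l => //.
  have -> : eA =
      2 ^- n * 2 `^ (n%:R * (Hb p + Hb q - Hb (bconv p q) + 3 * eps)).
    by rewrite /eA i2E -powR2D; congr (_ `^ _); ring.
  apply: ler_wpM2l => //.
  apply: le_trans (sum_jtypical_fiber p q eps n (wxor u v) hp hq).
  rewrite -[leRHS](sum_wxor u); apply: ler_sum => d _.
  suff -> : wxor (wxor u d) (wxor u v) = wxor v d by [].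
  by apply/ffunP => k; rewrite !ffunE; do !case: (_ k).
(* Both are wrong: the two noises receive independent uniform shifts, so two counts multiply. *)
- have -> : eAB =
      (2 ^- n * 2 `^ (n%:R * (Hb p + eps))) * (2 ^- n * 2 `^ (n%:R * (Hb q + eps))).
    by rewrite /eAB i2E -!powR2D; congr (_ `^ _); ring.
  set cp := 2 `^ _; set cq := 2 `^ _.
  have -> : NF * NG * (MA.-1%:R * MB.-1%:R * ((2 ^- n * cp) * (2 ^- n * cq))) =
     MA.-1%:R * (MB.-1%:R * (NF * (2 ^- n * (cp * (NG * (2 ^- n * cq)))))) by ring.
  rewrite -cB -cA.
  under eq_bigr => f _ do rewrite exchange_big /=.
  rewrite exchange_big; apply: ler_sum => a' aa' /=.
  under eq_bigr => f _ do rewrite exchange_big /=.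
  rewrite exchange_big; apply: ler_sum => b' bb' /=.
  (* The average over [g] is taken for fixed [f], then the average over [f]. *)
  under eq_bigr => f _ do rewrite (sum_random_code b b' (fun d =>
    (jtypical p q eps (wxor u (wxor (f a) (f a')))
      (wxor (wxor v (wxor (f a) (f a'))) d))%:R)) //.
  rewrite (sum_random_code a a' (fun d => NG * (2 ^- n * \sum_d'
    (jtypical p q eps (wxor u d) (wxor (wxor v d) d'))%:R))) //.
  apply: ler_wpM2l => //; apply: ler_wpM2l => //.
  apply: (@le_trans _ _ ((\sum_d (typical p eps (wxor u d))%:R) *
      (NG * (2 ^- n * cq)))); last first.
    apply: ler_wpM2r; first by rewrite !mulr_ge0 ?powR_ge0.
    by rewrite (sum_wxor u (fun d => (typical p eps d)%:R)) sum_typical.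
  rewrite mulr_suml; apply: ler_sum => d _.
  rewrite [leRHS]mulrCA; apply: ler_wpM2l => //.
  rewrite [leRHS]mulrCA; apply: ler_wpM2l => //.
  apply: (@le_trans _ _ ((typical p eps (wxor u d))%:R *
      \sum_d' (typical q eps (wxor (wxor v d) d'))%:R)); last first.
    apply: ler_wpM2l => //.
    by rewrite (sum_wxor (wxor v d) (fun d => (typical q eps d)%:R)) sum_typical.
  rewrite mulr_sumr; apply: ler_sum => d' _; rewrite -natrM ler_nat.
  by case: (boolP (jtypical _ _ _ _ _)) => // /and3P[-> ->].
Qed.

(** The error averaged over all pairs of codes satisfies the bound, hence so does that of some
    pair. *)
Lemma exists_code {R : realType} (p q eps delta : R) {n MA MB : nat} :
  (0 < MA)%N -> (0 < MB)%N -> 0 <= p <= 1 -> 0 <= q <= 1 ->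
  \sum_(u : word n) \sum_(v : word n) bsc_noise_prob p u * bsc_noise_prob q v *
    (~~ jtypical p q eps u v)%:R <= delta ->
  exists (f : 'I_MA -> word n) (g : 'I_MB -> word n)
    (dec : word n -> word n -> 'I_MA * 'I_MB),
    mac_err p q f g dec <= delta + random_coding_bound p q eps n MA MB.
Proof.
move=> MA0 MB0 hp hq hdelta.
set B := random_coding_bound _ _ _ _ _ _.
pose z0 : 'I_MA * 'I_MB := (Ordinal MA0, Ordinal MB0).
pose FG := ({ffun 'I_MA -> word n} * {ffun 'I_MB -> word n})%type.
pose e (fg : FG) := mac_err p q fg.1 fg.2 (jdecode p q eps z0 fg.1 fg.2).
suff : \sum_fg e fg <= #|{: FG}|%:R * (delta + B).
  move/(exists_le_mean (finfun (fun=> [ffun=> false]), finfun (fun=> [ffun=> false]))).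
  by case=> -[f g] he; exists f, g, (jdecode p q eps z0 f g).
rewrite card_prod natrM.
have M0 : 0 < MA%:R * MB%:R :> R by rewrite mulr_gt0 ?ltr0n.
rewrite -mulr_sumr ler_pdivrMl //.
set NF : R := #|_|%:R; set NG : R := #|_|%:R.
have -> : MA%:R * MB%:R * (NF * NG * (delta + B)) =
    \sum_(a < MA) \sum_(b < MB) (NF * NG * (delta + B)).
  rewrite sumr_const sumr_const !card_ord -[RHS]mulr_natl -[X in _ = _ * X]mulr_natl.
  by rewrite -[LHS]mulrA.
rewrite exchange_big; apply: ler_sum => a _ /=.
rewrite exchange_big; apply: ler_sum => b _ /=.
rewrite exchange_big /=.
under eq_bigr => u _ do rewrite exchange_big /=.
under eq_bigr => u _ do under eq_bigr => v _ do rewrite -mulr_sumr.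
apply: (@le_trans _ _ (\sum_(u : word n) \sum_(v : word n)
    bsc_noise_prob p u * bsc_noise_prob q v *
    (NF * NG * ((~~ jtypical p q eps u v)%:R + B)))).
  apply: ler_sum => u _; apply: ler_sum => v _.
  apply: ler_wpM2l; first by rewrite mulr_ge0 ?noise_ge0.
  rewrite -(pair_big xpredT xpredT (fun (f : {ffun 'I_MA -> word n})
    (g : {ffun 'I_MB -> word n}) => (jdecode p q eps z0 f g
    (wxor (f a) u) (wxor (wxor (f a) (g b)) v) != (a, b))%:R)) /=.
  exact: sum_jdecode_err.
under eq_bigr => u _ do under eq_bigr => v _ do rewrite mulrCA mulrDr.
under eq_bigr => u _ do rewrite -mulr_sumr big_split /= -mulr_suml.
rewrite -mulr_sumr big_split /= -mulr_suml sum_noise_pair mul1r.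
by apply: ler_wpM2l; rewrite ?mulr_ge0 ?lerD2r.
Qed.

(** * Asymptotics *)

Lemma num_msgs_gt0 {R : realType} n (r : R) : 0 <= r -> (0 < num_msgs n r)%N.
Proof.
move=> r0; rewrite /num_msgs truncn_ge_nat ?powR_ge0 //.
by rewrite -[X in X <= _](powRr0 2) powR2_le mulr_ge0.
Qed.

Lemma num_msgs_le {R : realType} n (r : R) : (num_msgs n r)%:R <= 2 `^ (n%:R * r).
Proof. by have /andP[] := truncn_itv (powR_ge0 2 (n%:R * r)). Qed.

(** There is at least one message, so rounding down loses at most a factor 2. *)
Lemma num_msgs_ge {R : realType} n (r : R) :
  0 <= r -> 2 `^ (n%:R * r) <= 2 * (num_msgs n r)%:R.
Proof.
move=> r0; apply: (le_trans (ltW (truncnS_gt _))).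
rewrite -natrM ler_nat -/(num_msgs n r).
by rewrite mul2n -addnn -addn1 leq_add2l num_msgs_gt0.
Qed.

Lemma num_msgs_pred_le {R : realType} n (r : R) :
  (num_msgs n r).-1%:R <= 2 `^ (n%:R * r).
Proof. by apply: le_trans (num_msgs_le n r); rewrite ler_nat leq_pred. Qed.

Lemma num_msgs0 {R : realType} n : num_msgs n (0 : R) = 1%N.
Proof. by rewrite /num_msgs mulr0 powRr0 truncn1. Qed.

(** A constant factor does not affect the exponent: if [c < r], then [n * (r - c)] exceeds [k] for
    large [n]. *)
Lemma rate_le {R : realType} (r c k : R) (N : nat) :
  (forall n : nat, (N <= n)%N -> 2 `^ (n%:R * r) <= 2 `^ k * 2 `^ (n%:R * c)) ->
  r <= c.
Proof.
move=> h; rewrite leNgt; apply/negP => cr.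
pose n := (N + (Num.truncn (k / (r - c))).+1)%N.
have := h n (leq_addr _ _); rewrite -powR2D powR2_le -lerBlDr -mulrBr.
apply/negP; rewrite -ltNge -ltr_pdivrMr ?subr_gt0 //.
by rewrite (lt_le_trans (truncnS_gt _)) // ler_nat leq_addl.
Qed.

Lemma powR2_decay {R : realType} (r c delta : R) : r < c -> 0 < delta ->
  exists N : nat, forall n : nat, (N <= n)%N ->
  2 `^ (n%:R * r) * 2 `^ (- (n%:R * c)) <= delta.
Proof.
move=> rc delta0; exists (Num.truncn (- log2 delta / (c - r))).+1 => n Nn.
rewrite -powR2D -[leRHS]powR2_log2 // powR2_le -mulrN -mulrDr.
rewrite -lerN2 -[leRHS]mulrN opprB -ler_pdivrMr ?subr_gt0 //.
by rewrite (le_trans (ltW (truncnS_gt _))) // ler_nat.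
Qed.

(** * Converse and achievability for single rate pairs *)

(** With error and atypicality each at most [1 / 4], at least half of the mass is good. *)
Lemma achievable_good {R : realType} (p13 p14 p23 p34 rA rB eps : R)
    (q := p_prime p13 p23 p34) :
  0 <= p14 <= 1 -> 0 <= q <= 1 -> 0 < eps -> achievable p13 p14 p23 p34 rA rB ->
  exists N : nat, forall n : nat, (N <= n)%N ->
  exists (f : 'I_(num_msgs n rA) -> word n) (g : 'I_(num_msgs n rB) -> word n) dec,
    (num_msgs n rA)%:R * (num_msgs n rB)%:R <=
    2 * mac_good p14 q eps f g dec.
Proof.
move=> hp hq eps0 [rA0 [rB0 ach]].
have d0 : 0 < 1 / 4 :> R by lra.
have [N1 hN1] := ach _ d0.
have [N2 hN2] := noise_jatypical p14 q eps (1 / 4) hp hq eps0 d0.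
exists (maxn N1 N2) => n; rewrite geq_max => /andP[/hN1[f [g [dec herr]]] /hN2 htyp].
exists f, g, dec; rewrite err_prob_mac -/q in herr.
have := mac_err_good p14 q eps (1 / 4) f g dec (num_msgs_gt0 n rA rA0)
  (num_msgs_gt0 n rB rB0) hp hq htyp.
set m := _%:R * _%:R; have m0 : 0 <= m by rewrite mulr_ge0.
have := ler_wpM2r m0 herr; lra.
Qed.

Lemma achievable_bounds {R : realType} (p13 p14 p23 p34 rA rB : R) :
  0 <= p14 <= 1 -> 0 <= p_prime p13 p23 p34 <= 1 ->
  achievable p13 p14 p23 p34 rA rB -> joint_bounds p13 p14 p23 p34 (rA, rB).
Proof.
set q := p_prime _ _ _ => hp hq ach.
have [rA0 [rB0 _]] := ach.
(* One factor 2 comes from [achievable_good] and one from rounding each message count, hence at most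
   8. *)
have K8 : 8 = 2 `^ 3%:R :> R by rewrite -pow2_powR; ring.
rewrite /joint_bounds /= p_secondE -/q; split=> //; split=> //; split; [|split].
(* [mac_good_fst] loses [3 * eps] in the exponent, so [eps] is [e / 3]. *)
- apply/ler_addgt0Pr => e e0; have e30 : 0 < e / 3 by lra.
  have [N hN] := achievable_good _ _ _ _ _ _ _ hp hq e30 ach.
  apply: (@rate_le _ _ _ 3%:R N) => n /hN[f [g [dec h]]]; rewrite -K8.
  have {h} := le_trans h (ler_wpM2l (ler0n R 2) (mac_good_fst p14 q _ f g dec hp hq)).
  rewrite [3 * (e / 3)]mulrC divfK ?pnatr_eq0 //.
  have MB0 : 0 < (num_msgs n rB)%:R :> R by rewrite ltr0n num_msgs_gt0.
  rewrite mulrCA [leLHS]mulrC ler_pM2l // => h.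
  have := num_msgs_ge n rA rA0; have := powR_ge0 2 (n%:R *
    (1 - Hb p14 + (1 - Hb q) - (1 - Hb (bconv p14 q)) + e)); lra.
- apply/ler_addgt0Pr => e e0.
  have [N hN] := achievable_good _ _ _ _ _ _ _ hp hq e0 ach.
  apply: (@rate_le _ _ _ 3%:R N) => n /hN[f [g [dec h]]]; rewrite -K8.
  have {h} := le_trans h (ler_wpM2l (ler0n R 2) (mac_good_snd p14 q _ f g dec hp hq)).
  have MA0 : 0 < (num_msgs n rA)%:R :> R by rewrite ltr0n num_msgs_gt0.
  rewrite mulrCA ler_pM2l // => h.
  have := num_msgs_ge n rB rB0; have := powR_ge0 2 (n%:R * (1 - Hb q + e)); lra.
- apply/ler_addgt0Pr => e e0; have e20 : 0 < e / 2 by lra.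
  have [N hN] := achievable_good _ _ _ _ _ _ _ hp hq e20 ach.
  apply: (@rate_le _ _ _ 3%:R N) => n /hN[f [g [dec h]]]; rewrite -K8.
  have {h} := le_trans h (ler_wpM2l (ler0n R 2) (mac_good_sum p14 q _ f g dec hp hq)).
  rewrite [2 * (e / 2)]mulrC divfK ?pnatr_eq0 // => h.
  rewrite mulrDr powR2D.
  have := ler_pM (powR_ge0 _ _) (powR_ge0 _ _) (num_msgs_ge n rA rA0)
    (num_msgs_ge n rB rB0).
  lra.
Qed.

(** For large [n] the atypical noise and the three terms of [random_coding_bound] are each at most
    [delta / 4]. *)
Lemma achievable_of_lt {R : realType} (p13 p14 p23 p34 rA rB : R)
    (q := p_prime p13 p23 p34) :
  0 <= p14 <= 1 -> 0 <= q <= 1 -> 0 <= rA -> 0 <= rB ->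
  (0 < rA -> rA < (1 - Hb p14) + (1 - Hb q) - (1 - Hb (bconv p14 q))) ->
  (0 < rB -> rB < 1 - Hb q) ->
  (0 < rA + rB -> rA + rB < (1 - Hb p14) + (1 - Hb q)) ->
  achievable p13 p14 p23 p34 rA rB.
Proof.
set CB := 1 - Hb q; set CS := _ + CB; set CA := CS - _.
move=> hp hq rA0 rB0 hA hB hS; split=> //; split=> // delta delta0.
(* At rate 0 the gap may be zero or negative; replacing it by 1 keeps the minimum [m] positive. *)
pose gap (x : R) := if 0 < x then x else 1.
have gap0 x : 0 < gap x by rewrite /gap; case: ifP.
pose m := Num.min (gap (CA - rA)) (Num.min (gap (CB - rB)) (gap (CS - (rA + rB)))).
have m0 : 0 < m by rewrite !lt_min !gap0.
(* With [eps = m / 4], the largest loss [3 * eps] stays below the gap. *)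
have mE (r c : R) : m <= gap (c - r) -> r < c -> r < c - 3 * (m / 4).
  by rewrite /gap subr_gt0 => + rc; rewrite rc => ?; lra.
have mA : m <= gap (CA - rA) by rewrite ge_min lexx.
have mB : m <= gap (CB - rB) by rewrite !ge_min lexx orbT.
have mS : m <= gap (CS - (rA + rB)) by rewrite !ge_min lexx !orbT.
have eps0 : 0 < m / 4 by lra.
have d4 : 0 < delta / 4 by lra.
have [N0 hN0] := noise_jatypical p14 q (m / 4) (delta / 4) hp hq eps0 d4.
have [NB hNB] : exists N : nat, forall n : nat, (N <= n)%N ->
    (num_msgs n rB).-1%:R * 2 `^ (- (n%:R * (CB - m / 4))) <= delta / 4.
  have [rBE|rBn] := eqVneq rB 0.
    by exists 0%N => n _; rewrite rBE num_msgs0 mul0r ltW.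
  have rBc : rB < CB - m / 4.
    by have := mE _ _ mB (hB _); rewrite lt0r rBn rB0 => /(_ isT); lra.
  have [N hN] := powR2_decay _ _ _ rBc d4.
  exists N => n /hN; apply: le_trans.
  by rewrite ler_wpM2r ?powR_ge0 ?num_msgs_pred_le.
have [NA hNA] : exists N : nat, forall n : nat, (N <= n)%N ->
    (num_msgs n rA).-1%:R * 2 `^ (- (n%:R * (CA - 3 * (m / 4)))) <= delta / 4.
  have [rAE|rAn] := eqVneq rA 0.
    by exists 0%N => n _; rewrite rAE num_msgs0 mul0r ltW.
  have rAc := mE _ _ mA (hA _); rewrite lt0r rAn rA0 in rAc.
  have [N hN] := powR2_decay _ _ _ (rAc isT) d4.
  exists N => n /hN; apply: le_trans.
  by rewrite ler_wpM2r ?powR_ge0 ?num_msgs_pred_le.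
have [NS hNS] : exists N : nat, forall n : nat, (N <= n)%N ->
    (num_msgs n rA).-1%:R * (num_msgs n rB).-1%:R *
    2 `^ (- (n%:R * (CS - 2 * (m / 4)))) <= delta / 4.
  (* At [rA = 0] the product of counts vanishes; otherwise the sum rate is positive and [hS]
     applies. *)
  have [rAE|rAn] := eqVneq rA 0.
    by exists 0%N => n _; rewrite rAE num_msgs0 !mul0r ltW.
  have rS0 : 0 < rA + rB by rewrite ltr_pwDl // lt0r rAn.
  have rSc : rA + rB < CS - 2 * (m / 4) by have := mE _ _ mS (hS rS0); lra.
  have [N hN] := powR2_decay _ _ _ rSc d4.
  exists N => n /hN; apply: le_trans.
  rewrite ler_wpM2r ?powR_ge0 // mulrDr powR2D.
  by apply: ler_pM => //; exact: num_msgs_pred_le.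
exists (maxn (maxn N0 NB) (maxn NA NS)) => n; rewrite !geq_max.
case/andP=> /andP[/hN0 h0 /hNB hb] /andP[/hNA ha /hNS hs].
have [f [g [dec h]]] := exists_code p14 q (m / 4) (delta / 4)
  (num_msgs_gt0 n rA rA0) (num_msgs_gt0 n rB rB0) hp hq h0.
exists f, g, dec; rewrite err_prob_mac -/q; apply: (le_trans h).
by rewrite /random_coding_bound -/CB -/CS -/CA; lra.
Qed.

(** * Closedness and convexity of the bounds, and the rate region *)

Lemma closed_joint_bounds {R : realType} (p13 p14 p23 p34 : R) :
  closed (joint_bounds p13 p14 p23 p34).
Proof.
rewrite /joint_bounds; set CA := _ - (_ - Hb (p_second _ _ _ _)).
set CB := 1 - Hb (p_prime _ _ _).
have le_closed (f g : R * R -> R) : continuous f -> continuous g ->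
    closed [set r | f r <= g r].
  move=> cf cg; rewrite (_ : [set r | _] = (fun r => f r - g r) @^-1` [set x | x <= 0]).
    apply: preimage_closed; last exact: closed_le.
    by move=> r _; apply: cvgB; [exact: cf|exact: cg].
  by apply/seteqP; split => r /=; rewrite subr_le0.
have cfst : continuous (fun r : R * R => r.1) by move=> r; exact: cvg_fst.
have csnd : continuous (fun r : R * R => r.2) by move=> r; exact: cvg_snd.
have ccst (c : R) : continuous (fun r : R * R => c) by move=> r; exact: cvg_cst.
have cadd : continuous (fun r : R * R => r.1 + r.2).
  by move=> r; apply: cvgD; [exact: cfst|exact: csnd].
do 4 ![apply: closedI; first exact: le_closed].
exact: le_closed.
Qed.

Lemma conv_hull_joint_bounds {R : realType} (p13 p14 p23 p34 : R) :
  conv_hull (joint_bounds p13 p14 p23 p34) = joint_bounds p13 p14 p23 p34.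
Proof.
apply/seteqP; split => [z [k [w [x [w0 [w1 [Sx ->]]]]]]|z Sz]; last first.
  exists 1%N, (fun=> 1), (fun=> z); split=> //.
  by rewrite !big_ord1 !mul1r; split=> //; split=> //; case: (z).
have wle (F : 'I_k -> R) c : (forall i, F i <= c) -> \sum_(i < k) w i * F i <= c.
  move=> Fc; rewrite -[leRHS]mul1r -[X in _ <= X * _]w1 mulr_suml.
  by apply: ler_sum => i _; exact: ler_wpM2l.
have wge (F : 'I_k -> R) : (forall i, 0 <= F i) -> 0 <= \sum_(i < k) w i * F i.
  by move=> F0; apply: sumr_ge0 => i _; exact: mulr_ge0.
split; first by apply: wge => i; case: (Sx i).
split; first by apply: wge => i; case: (Sx i) => _ [].
split; first by apply: wle => i; case: (Sx i) => _ [_ []].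
split; first by apply: wle => i; case: (Sx i) => _ [_ [_ []]].
rewrite /= -big_split /=; under eq_bigr => i _ do rewrite -mulrDr.
by apply: wle => i; case: (Sx i) => _ [_ [_ []]].
Qed.

Lemma p_prime01 {R : realType} (p13 p23 p34 : R) :
  0 <= p13 <= 1 -> 0 <= p23 <= 1 -> 0 <= p34 <= 1 ->
  0 <= p_prime p13 p23 p34 <= 1.
Proof. by move=> h13 h23 h34; rewrite p_primeE; do 2 ?apply: bconv01. Qed.

Theorem theorem3 (R : realType) (p13 p14 p23 p34 : R)
  (h13 : 0 <= p13 <= 1) (h14 : 0 <= p14 <= 1)
  (h23 : 0 <= p23 <= 1) (h34 : 0 <= p34 <= 1) :
  joint_region p13 p14 p23 p34 = conv_hull (joint_bounds p13 p14 p23 p34).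
Proof.
have hq := p_prime01 p13 p23 p34 h13 h23 h34.
rewrite conv_hull_joint_bounds; apply/seteqP; split.
  (* The bounds being closed, it suffices to prove them for achievable pairs. *)
  rewrite /joint_region [X in _ `<=` X](closure_id _).1; last first.
    exact: closed_joint_bounds.
  by apply: closure_subset => -[rA rB]; exact: achievable_bounds.
move=> [rA rB]; rewrite /joint_bounds p_secondE /=.
move=> [rA0 [rB0 [hA [hB hS]]]].
move=> B /nbhs_ballP[e /= e0 eB].
(* [t <= 1 / 2] keeps [1 - t] positive; the second bound makes the displacements [t * rA] and
   [t * rB] smaller than [e]. *)
pose t := Num.min (1 / 2) (e / (2 * (rA + rB + 1))).
have t0 : 0 < t.
  by rewrite lt_min; apply/andP; split; [lra|apply: divr_gt0 => //; lra].
have t12 : t <= 1 / 2 by rewrite ge_min lexx.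
have te : t * (2 * (rA + rB + 1)) <= e.
  by rewrite -ler_pdivlMr ?ge_min ?lexx ?orbT //; lra.
exists ((1 - t) * rA, (1 - t) * rB); split => /=.
  apply: achievable_of_lt => //.
  - by rewrite mulr_ge0 //; lra.
  - by rewrite mulr_ge0 //; lra.
  (* A positive rate strictly decreases under the scaling, so the weak bound on it becomes
     strict. *)
  - rewrite pmulr_rgt0; last by lra.
    by move=> rAp; apply: lt_le_trans hA; rewrite mulrBl mul1r gtrBl mulr_gt0.
  - rewrite pmulr_rgt0; last by lra.
    by move=> rBp; apply: lt_le_trans hB; rewrite mulrBl mul1r gtrBl mulr_gt0.
  - rewrite -mulrDr pmulr_rgt0; last by lra.
    by move=> rp; apply: lt_le_trans hS; rewrite mulrBl mul1r gtrBl mulr_gt0.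
have tA := mulr_ge0 (ltW t0) rA0; have tB := mulr_ge0 (ltW t0) rB0.
apply: eB; split => /=; rewrite /ball /= ltr_norml; apply/andP; split; lra.
Qed.
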